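(* Assume the Exponential Time Hypothesis (ETH). There is a 1-layer, $O(n^2)$-width ReLU network $G_1$ and an observation $x$ such that the computational complexity to determine whether there exists a $z\in\{0,1\}^n$ with $\|G_1(z)-x\|_p\le\delta$ is $2^{\Omega(n)}$ for a given $\delta>0$ and any positive even number $p$.
   Context: ReLU acts coordinatewise by $\mathrm{ReLU}(t)=\max\{t,0\}$. A 1-layer ReLU network $G_1:\mathbb{R}^n\to\mathbb{R}^{m_1}$ is given by a weight matrix $W_1\in\mathbb{R}^{m_1\times n}$ and a bias $b_1\in\mathbb{R}^{m_1}$ via $G_1(z)=\mathrm{ReLU}(W_1z+b_1)$; its width is $m_1$, and $n$ is the dimension of the latent vector $z$. $\|\cdot\|_p$ is the $\ell_p$-norm. The problem considered is approximate inversion as a decision problem: a ReLU network, an observation $x$ and a parameter $\delta>0$ are given, and one must decide whether such a $z$ exists. 3-SAT: given a SAT formula on $n$ variables with each clause of size 3, decide whether it is satisfiable. ETH: there exists $\gamma>0$ such that 3-SAT cannot be solved in time $2^{\gamma n}$. *)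

(* Defs.v *)
From HB Require Import structures.
From mathcomp Require Import all_boot all_order all_algebra.
From mathcomp Require Import reals exp.

Set Implicit Arguments.
Unset Strict Implicit.
Unset Printing Implicit Defensive.

Import Order.TTheory GRing.Theory Num.Theory.
Local Open Scope ring_scope.

Definition relu {R : realDomainType} (t : R) : R := Num.max t 0.

Definition relu_layer {R : realDomainType} (m n : nat)
    (W : 'M[R]_(m, n)) (b : 'cV[R]_m) (z : 'cV[R]_n) : 'cV[R]_m :=
  map_mx relu (W *m z + b).

Definition lpnorm {R : realType} (p m : nat) (v : 'cV[R]_m) : R :=
  (\sum_(i < m) `|v i 0| ^+ p) `^ (p%:R^-1).

(* Model of computation: the random access machine of Cook and Reckhow, with
   unit cost per instruction.  The machine has registers, addressed by
   constants, and a memory, addressed indirectly.  Multiplication is not an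
   instruction, so that a machine running for t steps only handles numbers with
   O(t) more bits than its input and its constants; the model is therefore
   polynomially equivalent to Turing machines. *)

Inductive instr : Type :=
  | Const of nat & nat
  | Add of nat & nat & nat
  | Sub of nat & nat & nat
  | Fetch of nat & nat
  | Store of nat & nat
  | JumpZ of nat & nat
  | Halt of bool.

Definition program := seq instr.

Record config := Config { pc : nat; reg : nat -> nat; mem : nat -> nat }.

Definition upd (f : nat -> nat) (i v : nat) : nat -> nat :=
  fun j => if j == i then v else f j.

Definition exec (a : instr) (s : config) : config :=
  let: Config l r m := s in
  match a with
  | Const i c => Config l.+1 (upd r i c) m
  | Add i j k => Config l.+1 (upd r i (r j + r k)%N) m
  | Sub i j k => Config l.+1 (upd r i (r j - r k)%N) m
  | Fetch i j => Config l.+1 (upd r i (m (r j))) m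
  | Store i j => Config l.+1 r (upd m (r i) (r j))
  | JumpZ i l' => Config (if r i == 0%N then l' else l.+1) r m
  | Halt _ => s
  end.

(* The answer of P started in s, if P halts within t steps; a jump outside of
   the program halts with the answer false. *)
Fixpoint run (P : program) (t : nat) (s : config) : option bool :=
  if t is t'.+1 then
    match nth (Halt false) P (pc s) with
    | Halt b => Some b
    | a => run P t' (exec a s)
    end
  else None.

(* The input word is in memory, one letter per cell, its length in r_0. *)
Definition init (w : seq nat) : config :=
  Config 0 (upd (fun=> 0%N) 0 (size w)) (nth 0%N w).

(* A decision problem, whose instances are written as words and have a
   distinguished size parameter, called n in running times. *)
Record problem := Problem {
  instance : Type;
  encode : instance -> seq nat;
  param : instance -> nat;
  yes : instance -> Prop
}.

(* P decides L in time T(n), up to a factor polynomial in the length of the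
   input.  This factor is needed for bounds in n alone to make sense, since the
   length of an instance is not bounded in terms of n (a formula may repeat
   clauses, a network may have weights of arbitrary precision). *)
Definition decides_in_time {R : realType} (L : problem) (P : program)
    (T : nat -> R) : Prop :=
  exists c : nat, forall I : instance L, exists (t : nat) (ans : bool),
    [/\ t%:R <= (c * (size (encode I)).+1 ^ c)%:R * T (param I),
        run P t (init (encode I)) = Some ans
      & ans <-> yes I].

Definition solvable_in_time {R : realType} (L : problem) (T : nat -> R) : Prop :=
  exists P : program, decides_in_time L P T.

(* The complexity of L is 2^{Omega(n)}. *)
Definition exponentially_hard (R : realType) (L : problem) : Prop :=
  exists gamma : R, 0 < gamma /\
    ~ solvable_in_time L (fun n => 2 `^ (gamma * n%:R)).

(* Words over the alphabet {0, 1, 2}: each number is written in binary, least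
   significant bit first, and is terminated by the letter 2. *)
Definition encode_nat (k : nat) : seq nat :=
  rcons [seq (k %/ 2 ^ i %% 2)%N | i <- iota 0 (up_log 2 k.+1)] 2%N.

Definition encode_nats (s : seq nat) : seq nat := flatten (map encode_nat s).

Definition rat_code (q : rat) : seq nat :=
  [:: nat_of_bool (q < 0); `|numq q|%N; `|denq q|%N].

Definition mx_code (m n : nat) (A : 'M[rat]_(m, n)) : seq nat :=
  flatten [seq rat_code (A i j) | i <- enum 'I_m, j <- enum 'I_n].

(* A literal (v, s) holds iff variable v has value s. *)
Definition clause3 (n : nat) := 3.-tuple ('I_n * bool).

Record formula3 := Formula3 { nvars : nat; clauses : seq (clause3 nvars) }.

Definition satisfiable (phi : formula3) : Prop :=
  exists a : 'I_(nvars phi) -> bool,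
    all (fun c : clause3 (nvars phi) => has (fun l => a l.1 == l.2) c)
        (clauses phi).

Definition formula3_code (phi : formula3) : seq nat :=
  nvars phi ::
  flatten [seq flatten [seq [:: nat_of_ord l.1; nat_of_bool l.2] | l <- tval c]
          | c <- clauses phi].

Definition three_SAT : problem :=
  {| instance := formula3;
     encode := encode_nats \o formula3_code;
     param := nvars;
     yes := satisfiable |}.

Definition ETH (R : realType) : Prop := exponentially_hard R three_SAT.

(* A 1-layer ReLU network and an observation.  Being the input of an algorithm,
   they have rational entries. *)
Record inversion_instance := InversionInstance {
  latent_dim : nat;
  width : nat;
  weights : 'M[rat]_(width, latent_dim);
  bias : 'cV[rat]_width;
  observation : 'cV[rat]_width
}.

Definition network {R : realType} (I : inversion_instance) :
    'cV[R]_(latent_dim I) -> 'cV[R]_(width I) :=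
  relu_layer (map_mx ratr (weights I)) (map_mx ratr (bias I)).

Arguments network {R} I z.

Definition binary {R : realType} (n : nat) (z : 'cV[R]_n) : Prop :=
  forall i, z i 0 = 0 \/ z i 0 = 1.

Definition approx_invertible {R : realType} (p : nat) (delta : R)
    (I : inversion_instance) : Prop :=
  exists z : 'cV[R]_(latent_dim I),
    binary z /\ lpnorm p (network I z - map_mx ratr (observation I)) <= delta.

Definition inversion_code (I : inversion_instance) : seq nat :=
  [:: latent_dim I, width I
    & mx_code (weights I) ++ mx_code (bias I) ++ mx_code (observation I)].

Definition approx_inversion {R : realType} (C p : nat) (delta : R) : problem :=
  {| instance := {I : inversion_instance | width I <= C * latent_dim I ^ 2}%N;
     encode := fun I => encode_nats (inversion_code (sval I));
     param := fun I => latent_dim (sval I);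
     yes := fun I => approx_invertible p delta (sval I) |}.

(* Main.v *)
(* Let l(z) be the value of a literal, i.e. z_v or 1 - z_v.  The clauses of a
   3-SAT formula are grouped by their first two literals: the neuron of the pair
   (l1, l2) computes the ReLU of 2^e times the sum, over the clauses
   l1 \/ l2 \/ l3 of the group, of 1 - l1(z) - l2(z) - l3(z).  If one of l1, l2
   holds then no term is positive; if both fail then each term is 1 - l3(z), so
   the sum is positive iff some clause of the group fails.  With the observation
   0 and 2^e > delta, approximate inversion by a binary z thus amounts to
   satisfaction of all the clauses.  There are (2n)^2 neurons whatever the number
   of clauses, so no sparsification is needed, and the latent dimension is n.

   It remains to run this reduction on the machine, in front of a given program
   for approximate inversion.  The reduction only appends to the memory, and the
   given program is relocated to fresh registers and to the memory behind the
   input and the scratch data.  As n is written in binary, the network may be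
   exponentially longer than the formula, but its length is polynomial in n and
   in the length of the formula; halving the exponent absorbs the powers of n. *)

From mathcomp Require Import all_boot all_order all_algebra.
From mathcomp Require Import reals exp boolp.
From mathcomp Require Import zify ring lra.
Require Import Defs.

Import Order.TTheory GRing.Theory Num.Theory.

Set Implicit Arguments.
Unset Strict Implicit.
Unset Printing Implicit Defensive.

(** * A structured language for the machine *)

(* A state of the list-based semantics: registers and memory cells beyond the
   end of the lists hold 0. *)
Definition state : Type := seq nat * seq nat.

Definition config_at (l : nat) (s : state) : config :=
  Config l (nth 0 s.1) (nth 0 s.2).

Definition straight (a : instr) : bool :=
  match a with JumpZ _ _ | Halt _ => false | _ => true end.

Definition step (s : state) (a : instr) : state :=
  let: (r, m) := s in
  match a with
  | Const i c => (set_nth 0 r i c, m)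
  | Add i j k => (set_nth 0 r i (nth 0 r j + nth 0 r k), m)
  | Sub i j k => (set_nth 0 r i (nth 0 r j - nth 0 r k), m)
  | Fetch i j => (set_nth 0 r i (nth 0 m (nth 0 r j)), m)
  | Store i j => (r, set_nth 0 m (nth 0 r i) (nth 0 r j))
  | JumpZ _ _ | Halt _ => s
  end.

Lemma upd_nth (r : seq nat) (i v : nat) :
  upd (nth 0 r) i v = nth 0 (set_nth 0 r i v).
Proof. by apply: funext => j; rewrite nth_set_nth /upd /=. Qed.

Lemma exec_step (a : instr) (l : nat) (s : state) :
  straight a -> exec a (config_at l s) = config_at l.+1 (step s a).
Proof. by case: s => r m; case: a => //= *; rewrite upd_nth. Qed.

Lemma run_straight (P : program) (a : instr) (t l : nat) (s : state) :
  straight a -> nth (Halt false) P l = a ->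
  run P t.+1 (config_at l s) = run P t (config_at l.+1 (step s a)).
Proof. by move=> sa Pa; rewrite -exec_step //= Pa; case: a sa {Pa}. Qed.

Lemma run_jump (P : program) (i l l' t : nat) (s : state) :
  nth (Halt false) P l = JumpZ i l' ->
  run P t.+1 (config_at l s) =
  run P t (config_at (if nth 0 s.1 i == 0 then l' else l.+1) s).
Proof. by move=> Pl; rewrite /= Pl. Qed.

Arguments run : simpl never.

(** * Structured commands, their compilation, and rules for running them *)

Inductive cmd : Type :=
  | Block of seq instr
  | Seq of cmd & cmd
  | If of nat & cmd & cmd
  | While of nat & cmd.

Fixpoint csize (c : cmd) : nat :=
  match c with
  | Block b => size b
  | Seq c1 c2 => csize c1 + csize c2
  | If _ c1 c2 => csize c1 + csize c2 + 2
  | While _ c1 => csize c1 + 2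
  end.

(* Register 1 is assumed to hold 0, so that JumpZ 1 is unconditional. *)
Fixpoint compile (o : nat) (c : cmd) : program :=
  match c with
  | Block b => b
  | Seq c1 c2 => compile o c1 ++ compile (o + csize c1) c2
  | If i c1 c2 =>
      JumpZ i (o + csize c1 + 2) ::
      compile o.+1 c1 ++ JumpZ 1 (o + csize c1 + csize c2 + 2) ::
      compile (o + csize c1 + 2) c2
  | While i c1 =>
      JumpZ i (o + csize c1 + 2) :: rcons (compile o.+1 c1) (JumpZ 1 o)
  end.

Lemma size_compile (c : cmd) (o : nat) : size (compile o c) = csize c.
Proof.
elim: c o => [b|c1 IH1 c2 IH2|i c1 IH1 c2 IH2|i c1 IH1] o //=.
- by rewrite size_cat IH1 IH2.
- by rewrite size_cat /= IH1 IH2; lia.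
- by rewrite size_rcons IH1; lia.
Qed.

(** Quantifying over the surrounding code and over the fuel [k] left at the end makes the rules
    compose; [t] is only an upper bound, so that it may be rounded up. *)
Definition runs (c : cmd) (s : state) (t : nat) (s' : state) : Prop :=
  forall p1 p2 : program,
    let P := p1 ++ compile (size p1) c ++ p2 in
    exists2 t', t' <= t & forall k,
      run P (t' + k) (config_at (size p1) s) =
      run P k (config_at (size p1 + csize c) s').

Lemma runs_le (c : cmd) (s s' : state) (t1 t2 : nat) :
  t1 <= t2 -> runs c s t1 s' -> runs c s t2 s'.
Proof.
by move=> le12 H p1 p2; have [t le Ht] := H p1 p2; exists t => //; lia.
Qed.

Lemma runs_block (b : seq instr) (s : state) :
  all straight b -> runs (Block b) s (size b) (foldl step s b).
Proof.
move=> sb p1 p2 P; exists (size b) => // k; rewrite {}/P /=.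
elim: b p1 s sb => [|a b IH] p1 s /= => [_|/andP[sa sb]].
  by rewrite addn0.
rewrite addSn (@run_straight _ a) //; last first.
  by rewrite nth_cat ltnn subnn.
by rewrite -cat_rcons -addSnnS -(size_rcons p1 a) IH.
Qed.

Lemma runs_block_eq (b : seq instr) (s s' : state) (t : nat) :
  all straight b -> size b <= t -> foldl step s b = s' ->
  runs (Block b) s t s'.
Proof. by move=> sb le <-; apply: runs_le le (runs_block _ sb). Qed.

Lemma runs_seq (c1 c2 : cmd) (s1 s2 s3 : state) (t1 t2 : nat) :
  runs c1 s1 t1 s2 -> runs c2 s2 t2 s3 -> runs (Seq c1 c2) s1 (t1 + t2) s3.
Proof.
move=> H1 H2 p1 p2 P.
have [t1' le1 E1] := H1 p1 (compile (size p1 + csize c1) c2 ++ p2).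
have := H2 (p1 ++ compile (size p1) c1) p2.
rewrite size_cat size_compile => -[t2' le2 E2].
exists (t1' + t2') => [|k]; first by lia.
rewrite {}/P /= -addnA -(catA (compile _ c1)) E1.
by rewrite (catA p1) E2 addnA.
Qed.

Lemma runs_if1 (i : nat) (c1 c2 : cmd) (s s' : state) (t : nat) :
  nth 0 s.1 i != 0 -> nth 0 s'.1 1 = 0 -> runs c1 s t s' ->
  runs (If i c1 c2) s (t + 2) s'.
Proof.
move=> si s'0 H p1 p2 P.
pose j := JumpZ i (size p1 + csize c1 + 2).
have := H (rcons p1 j) (JumpZ 1 (size p1 + csize c1 + csize c2 + 2) ::
   compile (size p1 + csize c1 + 2) c2 ++ p2).
rewrite size_rcons cat_rcons => -[t' le' E].
exists (t' + 2) => [|k]; first by lia.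
rewrite {}/P /= -catA /= -/j (_ : t' + 2 + k = (t' + k.+1).+1); last by lia.
rewrite (@run_jump _ i _ (size p1 + csize c1 + 2)); last first.
  by rewrite nth_cat ltnn subnn.
rewrite (negbTE si) E.
rewrite (@run_jump _ 1 _ (size p1 + csize c1 + csize c2 + 2)).
  by rewrite s'0 eqxx -!addnA.
rewrite nth_cat; case: ltnP; first by lia.
by move=> _; rewrite addSn subSn ?leq_addr //= nth_cat size_compile addKn ltnn subnn.
Qed.

Lemma runs_if0 (i : nat) (c1 c2 : cmd) (s s' : state) (t : nat) :
  nth 0 s.1 i = 0 -> runs c2 s t s' -> runs (If i c1 c2) s t.+1 s'.
Proof.
move=> si H p1 p2 P.
pose p1' := p1 ++ JumpZ i (size p1 + csize c1 + 2) ::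
   rcons (compile (size p1).+1 c1) (JumpZ 1 (size p1 + csize c1 + csize c2 + 2)).
have sz : size p1' = size p1 + csize c1 + 2.
  by rewrite size_cat /= size_rcons size_compile; lia.
have := H p1' p2; rewrite sz => -[t' le' E].
have eP : P = p1' ++ compile (size p1 + csize c1 + 2) c2 ++ p2.
  by rewrite /P /p1' -catA /= cat_rcons -catA.
exists t'.+1 => [|k]; first by lia.
rewrite addSn (@run_jump _ i _ (size p1 + csize c1 + 2)); last first.
  by rewrite nth_cat ltnn subnn.
by rewrite si eqxx eP E /=; congr (run _ _ (config_at _ _)); lia.
Qed.

Lemma runs_while0 (i : nat) (c : cmd) (s : state) :
  nth 0 s.1 i = 0 -> runs (While i c) s 1 s.
Proof.
move=> si p1 p2 P; exists 1 => // k.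
rewrite (@run_jump _ i _ (size p1 + csize c + 2)); last first.
  by rewrite nth_cat ltnn subnn.
by rewrite si eqxx /= addnA.
Qed.

Lemma runs_whileS (i : nat) (c : cmd) (s1 s2 s3 : state) (t1 t2 : nat) :
  nth 0 s1.1 i != 0 -> nth 0 s2.1 1 = 0 ->
  runs c s1 t1 s2 -> runs (While i c) s2 t2 s3 ->
  runs (While i c) s1 (t1 + 2 + t2) s3.
Proof.
move=> s1i s20 H1 H2 p1 p2 P.
pose j := JumpZ i (size p1 + csize c + 2).
have := H1 (rcons p1 j) (JumpZ 1 (size p1) :: p2).
rewrite size_rcons cat_rcons => -[t1' le1 E1].
have [t2' le2 E2] := H2 p1 p2.
exists (t1' + 2 + t2') => [|k]; first by lia.
rewrite (_ : t1' + 2 + t2' + k = (t1' + (t2' + k).+1).+1); last by lia.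
rewrite (@run_jump _ i _ (size p1 + csize c + 2)); last first.
  by rewrite nth_cat ltnn subnn.
rewrite (negbTE s1i) -E2 /P /= cat_rcons -/j E1.
rewrite (@run_jump _ 1 _ (size p1)) ?s20 ?eqxx //.
rewrite nth_cat; case: ltnP; first by lia.
by move=> _; rewrite addSn subSn ?leq_addr //= nth_cat size_compile addKn ltnn subnn.
Qed.

(** A loop is verified by exhibiting its states [F k] after [k] turns; the induction is on the
    number of turns left. *)
Lemma runs_while (i : nat) (c : cmd) (F : nat -> state) (t n : nat) :
  (forall k, k <= n -> (nth 0 (F k).1 i == 0) = (k == n)) ->
  (forall k, k <= n -> nth 0 (F k).1 1 = 0) ->
  (forall k, k < n -> runs c (F k) t (F k.+1)) ->
  runs (While i c) (F 0) (n * (t + 2) + 1) (F n).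
Proof.
move=> Fi F1 Fc.
suff H j : j <= n -> runs (While i c) (F (n - j)) (j * (t + 2) + 1) (F n).
  by have := H n (leqnn n); rewrite subnn.
elim: j => [_|j IH lejn].
  by rewrite subn0; apply: runs_while0; apply/eqP; rewrite Fi ?eqxx.
rewrite mulSn -addnA; apply: (@runs_whileS _ _ _ (F (n - j))).
- by rewrite Fi ?leq_subr //; lia.
- by rewrite F1 ?leq_subr.
- by rewrite (_ : n - j = (n - j.+1).+1); [apply: Fc|]; lia.
- exact: IH (ltnW lejn).
Qed.

(** * Binary numbers *)

Definition bits (k : nat) : seq nat :=
  [seq (k %/ 2 ^ i %% 2)%N | i <- iota 0 (up_log 2 k.+1)].

Lemma bits0 : bits 0 = [::].
Proof. by rewrite /bits up_log1. Qed.

Lemma bitsS (k : nat) : 0 < k -> bits k = nat_of_bool (odd k) :: bits k./2.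
Proof.
move=> k0; rewrite /bits up_log2S //= expn0 divn1 modn2; congr cons.
rewrite (iotaDl 1 0) -map_comp; apply: eq_map => i /=.
by rewrite add1n expnS divnMA divn2.
Qed.

Lemma set_nth_size (m : seq nat) (v : nat) : set_nth 0 m (size m) v = rcons m v.
Proof. by elim: m => //= x m ->. Qed.

(** Register 2 holds 1. The inner loop halves register 3 by repeated subtraction, leaving the
    quotient in register 4 and the last bit in register 3. This takes time linear in the number,
    which is affordable because the emitted numbers are polynomially bounded. *)
Definition emit_bits : cmd :=
  While 3
   (Seq (Block [:: Const 4 0; Sub 5 3 2])
   (Seq (While 5 (Block [:: Sub 3 3 2; Sub 3 3 2; Add 4 4 2; Sub 5 3 2]))
        (Block [:: Store 0 3; Add 0 0 2; Add 3 4 1]))).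

Lemma runs_emit_bits (k h t : nat) (g m : seq nat) : exists h' t',
  runs emit_bits ([:: size m, 0, 1, k, h, t & g], m) (14 * k + 1)
   ([:: size (m ++ bits k), 0, 1, 0, h', t' & g], m ++ bits k).
Proof.
elim/ltn_ind: k h t m => k IH h t m; case: (posnP k) => [->|k0].
  by exists h, t; rewrite bits0 cats0; apply: runs_while0.
have [|h' [t' H]] := IH k./2 _ k./2 (k - k./2 * 2 - 1) (rcons m (odd k)).
  by lia.
exists h', t'; rewrite bitsS // -cat_rcons.
apply: (@runs_le _ _ _ (2 + (k./2 * 6 + 1 + 3) + 2 + (14 * k./2 + 1))).
  by lia.
apply: runs_whileS H => //=; first by lia.
pose F i := ([:: size m, 0, 1, k - i * 2, i, k - i * 2 - 1 & g], m).
apply: (@runs_seq _ _ _ (F 0) _ 2).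
  by apply: runs_block_eq; rewrite //= /F mul0n subn0.
apply: (@runs_seq _ _ _ (F k./2) _ (k./2 * 6 + 1) 3).
  apply: (@runs_while _ _ _ 4) => [i lei|//|i lti] /=; first by lia.
  by apply: runs_block_eq; rewrite //= /F; congr (_, _); do ?congr cons; lia.
apply: runs_block_eq => //=.
have -> : k - k./2 * 2 = odd k by lia.
by rewrite set_nth_size size_rcons addn0 addn1; congr (_, _); do ?congr cons; lia.
Qed.

Definition emit : cmd :=
  Seq emit_bits
   (Block [:: Const 3 2; Store 0 3; Add 0 0 2; Const 3 0; Const 4 0; Const 5 0]).

Lemma runs_emit (k h t : nat) (g m : seq nat) :
  runs emit ([:: size m, 0, 1, k, h, t & g], m) (14 * k + 7)
   ([:: size (m ++ encode_nat k), 0, 1, 0, 0, 0 & g], m ++ encode_nat k).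
Proof.
have [h' [t' H]] := runs_emit_bits k h t g m.
rewrite (_ : 14 * k + 7 = 14 * k + 1 + 6); last by lia.
apply: runs_seq H _; apply: runs_block_eq => //=.
rewrite set_nth_size -[encode_nat k]/(rcons (bits k) 2) -rcons_cat.
by rewrite size_rcons addn1.
Qed.

(* The state is (value read so far, weight of the next bit, numbers read). *)
Definition decode_step (s : nat * nat * seq nat) (x : nat) :=
  let: (a, w, d) := s in
  if x == 2 then (0, 1, rcons d a) else (a + x * w, w + w, d).

(** The final weight is left existential, as the terminator resets it to 1. *)
Lemma decode_bits (k a w : nat) (d : seq nat) : exists w',
  foldl decode_step (a, w, d) (bits k) = (a + k * w, w', d).
Proof.
elim/ltn_ind: k a w => k IH a w; case: (posnP k) => [->|k0].
  by exists w; rewrite bits0 addn0.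
rewrite bitsS //=; have [|w' IHw] := IH k./2 _ (a + odd k * w) (w + w).
  by lia.
exists w'; rewrite -[RHS]/(_, w', d) (_ : _ == 2 = false); last by case: odd.
rewrite IHw; do 2?congr (_, _); rewrite -{3}(odd_double_half k) -muln2; ring.
Qed.

Lemma decode_encode (s d : seq nat) :
  foldl decode_step (0, 1, d) (encode_nats s) = (0, 1, d ++ s).
Proof.
elim: s d => [|k s IH] d; first by rewrite cats0.
rewrite /encode_nats /= foldl_cat -[encode_nat k]/(rcons (bits k) 2).
have [w' E] := decode_bits k 0 1 d.
by rewrite foldl_rcons E /= add0n muln1 IH cat_rcons.
Qed.

(** Register 7 is the reading address, 5 the letter read, 3 and 4 the value so far and the weight of
    the next bit. Register 6 is nonzero exactly on the terminator 2, and register 8 counts the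
    letters left. *)
Definition decode_loop : cmd :=
  While 8
   (Seq (Block [:: Fetch 5 7; Add 7 7 2; Sub 6 5 2])
   (Seq (If 6
     (Block [:: Store 0 3; Add 0 0 2; Const 3 0; Const 4 1])
     (Seq (If 5 (Block [:: Add 3 3 4]) (Block [::]))
          (Block [:: Add 4 4 4])))
     (Block [:: Const 5 0; Const 6 0; Sub 8 9 7]))).

Lemma mem_encode_nats (s : seq nat) : {in encode_nats s, forall x, x <= 2}.
Proof.
move=> x /flattenP[y /mapP[k _ ->]]; rewrite mem_rcons inE => /predU1P[-> //|].
by case/mapP => i _ ->; rewrite ltnW // ltn_mod.
Qed.

Definition decode : cmd :=
  Seq (Block [:: Const 2 1; Const 4 1; Add 9 0 1; Add 8 0 1]) decode_loop.

Lemma runs_decode (s : seq nat) :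
  let w := encode_nats s in
  runs decode ([:: size w], w) (size w * 16 + 5)
   ([:: size (w ++ s); 0; 1; 0; 1; 0; 0; size w; 0; size w], w ++ s).
Proof.
move=> w.
(* Invariant: after [i] letters the machine holds the state of the fold over them. *)
pose F i : state := let: (a, e, d) := foldl decode_step (0, 1, [::]) (take i w) in
  ([:: size (w ++ d); 0; 1; a; e; 0; 0; i; size w - i; size w], w ++ d).
have F0 : F 0 = ([:: size w; 0; 1; 0; 1; 0; 0; 0; size w; size w], w).
  by rewrite /F take0 /= cats0 subn0.
have Fn : F (size w) =
    ([:: size (w ++ s); 0; 1; 0; 1; 0; 0; size w; 0; size w], w ++ s).
  by rewrite /F take_size decode_encode subnn.
apply: runs_le (@runs_seq _ _ _ (F 0) _ 4 (size w * (14 + 2) + 1) _ _).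
- by lia.
- by apply: runs_block_eq; rewrite //= F0 addn0.
rewrite -Fn; apply: runs_while => [i lei|i _|i lti].
- by rewrite /F; case: foldl => [[a e] d] /=; lia.
- by rewrite /F; case: foldl => [[a e] d].
rewrite /F (take_nth 0 lti) foldl_rcons.
case: foldl => [[a e] d]; set x := nth 0 w i.
have x2 : x <= 2 by apply: (@mem_encode_nats s); exact: mem_nth.
apply: (@runs_seq _ _ _
  ([:: size (w ++ d); 0; 1; a; e; x; x - 1; i.+1; size w - i; size w], w ++ d) _ 3 11).
  by apply: runs_block_eq; rewrite //= nth_cat lti addn1.
rewrite /decode_step; case: eqP => x_eq.
  apply: (@runs_seq _ _ _
    ([:: size (w ++ rcons d a); 0; 1; 0; 1; x; x - 1; i.+1; size w - i; size w],
     w ++ rcons d a) _ 8 3).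
    apply: (@runs_if1 _ _ _ _ _ 6) => //; first by rewrite x_eq.
    apply: runs_block_eq; rewrite //= set_nth_size -rcons_cat.
    by rewrite size_rcons addn1.
  by apply: runs_block_eq.
apply: (@runs_seq _ _ _
  ([:: size (w ++ d); 0; 1; a + x * e; e + e; x; x - 1; i.+1; size w - i; size w],
   w ++ d) _ 8 3); last exact: runs_block_eq.
apply: (@runs_if0 _ _ _ _ _ 7); first by rewrite /=; lia.
apply: (@runs_seq _ _ _
  ([:: size (w ++ d); 0; 1; a + x * e; e; x; x - 1; i.+1; size w - i; size w],
   w ++ d) _ 6 1); last exact: runs_block_eq.
have [x0|x1] : x = 0 \/ x = 1 by lia.
  rewrite x0 mul0n addn0; apply: (@runs_if0 _ _ _ _ _ 5) => //.
  exact: runs_block_eq.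
rewrite x1 mul1n; apply: (@runs_if1 _ _ _ _ _ 4) => //.
exact: runs_block_eq.
Qed.

(** * Relocation of a program *)

(* Register i of the translated program is register k + i, and address a of its
   memory is address a + (register b); register t is scratch space. *)
Definition shift_instr (k b t o : nat) (a : instr) : seq instr :=
  match a with
  | Const i c => [:: Const (k + i) c; Const t 0]
  | Add i j l => [:: Add (k + i) (k + j) (k + l); Const t 0]
  | Sub i j l => [:: Sub (k + i) (k + j) (k + l); Const t 0]
  | Fetch i j => [:: Add t (k + j) b; Fetch (k + i) t]
  | Store i j => [:: Add t (k + i) b; Store t (k + j)]
  | JumpZ i l => [:: Const t 0; JumpZ (k + i) (o + l.*2)]
  | Halt r => [:: Halt r; Halt r]
  end.

Definition shift_program (k b t o : nat) (P : program) : program :=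
  flatten [seq shift_instr k b t o a | a <- P].

(** Each instruction becomes exactly two, padded if necessary, so that relative addresses are merely
    doubled. *)
Lemma nth_shift_program (k b t o : nat) (P : program) (l j : nat) : j < 2 ->
  nth (Halt false) (shift_program k b t o P) (l.*2 + j) =
  nth (Halt false) (shift_instr k b t o (nth (Halt false) P l)) j.
Proof.
move=> j2; elim: P l => [|a P IH] l.
  (* Beyond the end both sides are [Halt false], so jumps out of the program are preserved too. *)
  by rewrite !nth_nil; case: j j2 => [|[]].
rewrite /shift_program /= nth_cat.
have -> : size (shift_instr k b t o a) = 2 by case: a.
case: l => [|l]; first by rewrite j2.
rewrite ltnNge (_ : 2 <= l.+1.*2 + j) /=; last by lia.
by rewrite -IH (_ : l.+1.*2 + j - 2 = l.*2 + j) //; lia.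
Qed.

Lemma runS (P : program) (t : nat) (s : config) :
  run P t.+1 s = match nth (Halt false) P (pc s) with
    | Halt b => Some b
    | a => run P t (exec a s)
    end.
Proof. by []. Qed.

(** A simulation with two steps per step. As [b] and [t] lie below [k] and differ, the translated
    code never overwrites its memory base, and its scratch register is none of the simulated
    ones. *)
Lemma run_shift_program (k b t : nat) (p P : program) (n : nat)
    (s s' : config) (ans : bool) :
  b < k -> t < k -> b != t -> pc s' = size p + (pc s).*2 ->
  (forall i, reg s' (k + i) = reg s i) ->
  (forall a, mem s' (a + reg s' b) = mem s a) ->
  run P n s = Some ans ->
  run (p ++ shift_program k b t (size p) P) n.*2 s' = Some ans.
Proof.
move=> bk tk bt; elim: n s s' => // n IH [l r m] [l' r' m'] /= -> Er Em.
have nk i : (k + i == t) = false by lia.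
have nb i : (b == k + i) = false by lia.
have Q j : j < 2 -> nth (Halt false) (p ++ shift_program k b t (size p) P)
    (size p + l.*2 + j) =
    nth (Halt false) (shift_instr k b t (size p) (nth (Halt false) P l)) j.
  move=> j2; rewrite nth_cat -addnA ltnNge leq_addr /= addKn.
  exact: nth_shift_program.
rewrite doubleS; set d := n.*2 in IH *; rewrite !runS [pc _]/= [pc _]/=.
move: (Q 0 isT) (Q 1 isT); rewrite addn0 addn1 => -> {Q}.
case: (nth _ P l) => [i c|i j c|i j c|i j|i j|i c|c] /= E1 H;
  first [exact: H | rewrite runS /= E1; apply: IH H => //=; try lia].
all: try (move=> x; by rewrite /upd ?nk ?nb ?eqxx ?(negbTE bt)
  ?eqn_add2l ?eqn_add2r ?Er ?Em).
by rewrite /upd nk Er; case: ifP => _; lia.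
Qed.

(** * The code of the reduction *)

Definition literal : Type := nat * bool.
Definition nclause : Type := literal * literal * literal.

Definition nclause_code (c : nclause) : seq nat :=
  let: (l1, l2, l3) := c in
  [:: l1.1; nat_of_bool l1.2; l2.1; nat_of_bool l2.2; l3.1; nat_of_bool l3.2].

(** The literal $(v,s)$ has number $2v+s$; a pair of such numbers indexes a neuron. *)
Definition matches (i1 i2 : nat) (c : nclause) : bool :=
  let: (l1, l2, _) := c in
  (l1.1 + l1.1 + l1.2 == i1) && (l2.1 + l2.1 + l2.2 == i2).

(** The coefficient of $z_j$ in $1-l_1-l_2-l_3$ is split into two parts, as the machine only has
    natural numbers: a negated literal $1-z_j$ contributes $+1$, a plain one $-1$. *)
Definition weight_pos (i1 i2 j : nat) (c : nclause) : nat :=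
  let m (l : literal) := (matches i1 i2 c && (l.1 == j)) && ~~ l.2 in
  let: (l1, l2, l3) := c in m l1 + m l2 + m l3.

Definition weight_neg (i1 i2 j : nat) (c : nclause) : nat :=
  let m (l : literal) := (matches i1 i2 c && (l.1 == j)) && l.2 in
  let: (l1, l2, l3) := c in m l1 + m l2 + m l3.

(** The constant term of that expression is 1 minus the number of negated literals. *)
Definition bias_pos (i1 i2 : nat) (c : nclause) : nat := matches i1 i2 c.

Definition bias_neg (i1 i2 : nat) (c : nclause) : nat :=
  let m (l : literal) := matches i1 i2 c && ~~ l.2 in
  let: (l1, l2, l3) := c in m l1 + m l2 + m l3.

(* The registers of the emitter:
   0 first free address; 1, 2 the constants 0 and 1; 3-5 registers of emit;
   6, 7 positive and negative part of the current entry; 8, 9 address of the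
   current clause and distance to the end; 10-15 its literals; 16, 17 flags;
   18, 20, 22 the indices j, i2, i1 and 19, 21, 23 what remains of their ranges;
   24-27 n, 2n, end and beginning of the clauses. *)
Definition load_clause : seq instr :=
  flatten [seq [:: Fetch i 8; Add 8 8 2] | i <- iota 10 6].

(** Branch-free, by truncated subtraction: $1-((a-b)+(b-a))$ tests equality and $a+b-1$ is
    conjunction. A clause is thus treated by one straight block. *)
Definition flag_match : seq instr :=
  [:: Add 16 10 10; Add 16 16 11; Sub 17 16 22; Sub 16 22 16; Add 16 17 16;
      Sub 16 2 16; Add 17 12 12; Add 17 17 13; Sub 4 17 20; Sub 17 20 17;
      Add 17 4 17; Sub 17 2 17; Add 16 16 17; Sub 16 16 2].

(** Clearing the scratch registers restores the shape [registers] between clauses. *)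
Definition next_clause : seq instr :=
  rcons [seq Const i 0 | i <- 4 :: iota 10 8] (Sub 9 26 8).

Definition add_weight (v : nat) : seq instr :=
  [:: Sub 4 v 18; Sub 17 18 v; Add 17 4 17; Sub 17 2 17; Add 17 16 17;
      Sub 17 17 2; Sub 4 17 v.+1; Add 6 6 4; Add 4 17 v.+1; Sub 4 4 2; Add 7 7 4].

Definition weight_block : seq instr :=
  load_clause ++ flag_match ++
  add_weight 10 ++ add_weight 12 ++ add_weight 14 ++ next_clause.

Definition add_bias (v : nat) : seq instr := [:: Sub 4 16 v.+1; Add 7 7 4].

Definition bias_block : seq instr :=
  load_clause ++ flag_match ++
  Add 6 6 16 :: add_bias 10 ++ add_bias 12 ++ add_bias 14 ++ next_clause.

Definition registers (o k a b p d j dj i2 d2 i1 d1 n e f : nat) : seq nat :=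
  [:: o; 0; 1; k; 0; 0; a; b; p; d; 0; 0; 0; 0; 0; 0; 0; 0;
      j; dj; i2; d2; i1; d1; n; n + n; e; f].

Lemma eqnE (a b : nat) : 1 - (a - b + (b - a)) = (a == b).
Proof. lia. Qed.

Lemma andnE (a b : bool) : a + b - 1 = a && b.
Proof. by case: a; case: b. Qed.

Lemma andNnE (a b : bool) : a - b = a && ~~ b.
Proof. by case: a; case: b. Qed.

(* /= does not terminate in reasonable time on these blocks. *)
Ltac eval_block :=
  cbv beta iota delta [foldl step set_nth ncons iter nth registers fst snd cat
    rcons flatten foldr map iota load_clause flag_match next_clause
    weight_block add_weight bias_block add_bias].

(** Abstracting the increments [f] and [g] lets one proof about scanning serve weights and
    biases. *)
Definition block_spec (b : seq instr) (f g : nat -> nat -> nat -> nclause -> nat) :=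
  forall (m : seq nat) (c : nclause) (o x y p d j dj i2 d2 i1 d1 n e q : nat),
  (forall r, r < 6 -> nth 0 m (p + r) = nth 0 (nclause_code c) r) ->
  foldl step (registers o 0 x y p d j dj i2 d2 i1 d1 n e q, m) b =
  (registers o 0 (x + f i1 i2 j c) (y + g i1 i2 j c) (p + 6) (e - (p + 6))
     j dj i2 d2 i1 d1 n e q, m).

Lemma load_values (m : seq nat) (p : nat) (c : nclause) :
  (forall r, r < 6 -> nth 0 m (p + r) = nth 0 (nclause_code c) r) ->
  let: (l1, l2, l3) := c in
  [/\ nth 0 m p = l1.1, nth 0 m (p + 1) = l1.2, nth 0 m (p + 1 + 1) = l2.1,
      nth 0 m (p + 1 + 1 + 1) = l2.2 & nth 0 m (p + 1 + 1 + 1 + 1) = l3.1 /\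
      nth 0 m (p + 1 + 1 + 1 + 1 + 1) = l3.2].
Proof.
case: c => [[l1 l2] l3] H; rewrite -!addnA.
have := (H 0 isT, H 1 isT, H 2 isT, H 3 isT, H 4 isT, H 5 isT).
by rewrite /= addn0 => -[[[[[-> ->] ->] ->] ->] ->].
Qed.

Lemma weight_blockP : block_spec weight_block weight_pos weight_neg.
Proof.
move=> m [[[v1 s1] [v2 s2]] [v3 s3]] o x y p d j dj i2 d2 i1 d1 n e q.
move/load_values; rewrite ![fst _]/= ![snd _]/= => -[].
eval_block => H0 H1 H2 H3 [H4 H5].
rewrite H0 H1 H2 H3 ?H4 H5 !eqnE !andnE !andNnE /weight_pos /weight_neg /matches /=.
by rewrite (_ : p + 6 = p + 1 + 1 + 1 + 1 + 1 + 1) ?addnA // -!addnA.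
Qed.

Lemma bias_blockP :
  block_spec bias_block (fun i1 i2 _ => bias_pos i1 i2)
    (fun i1 i2 _ => bias_neg i1 i2).
Proof.
move=> m [[[v1 s1] [v2 s2]] [v3 s3]] o x y p d j dj i2 d2 i1 d1 n e q.
move/load_values; rewrite ![fst _]/= ![snd _]/= => -[].
eval_block => H0 H1 H2 H3 [H4 H5].
rewrite H0 H1 H2 H3 ?H4 H5 !eqnE !andnE !andNnE /bias_pos /bias_neg /matches /=.
by rewrite (_ : p + 6 = p + 1 + 1 + 1 + 1 + 1 + 1) ?addnA // -!addnA.
Qed.

Lemma encode_nats_cat (s1 s2 : seq nat) :
  encode_nats (s1 ++ s2) = encode_nats s1 ++ encode_nats s2.
Proof. by rewrite /encode_nats map_cat flatten_cat. Qed.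

Lemma encode_nats_rcons (s : seq nat) (k : nat) :
  encode_nats (rcons s k) = encode_nats s ++ encode_nat k.
Proof. by rewrite -cats1 encode_nats_cat /encode_nats /= cats0. Qed.

Definition scan (b : seq instr) : cmd :=
  Seq (Block [:: Add 8 27 1; Sub 9 26 8])
  (Seq (While 9 (Block b)) (Block [:: Const 8 0])).

(** Multiplication by $2^e$; [e] is a constant of the program, so the loop is unrolled. *)
Definition doubles (e : nat) : cmd :=
  iter e (Seq (Block [:: Add 3 3 3])) (Block [::]).

(** Emits sign, absolute value and denominator. The double complement $1-(1-(b-a))$ turns a
    truncated difference into the truth value of $a<b$. *)
Definition finish_entry (e : nat) : cmd :=
  Seq (Block [:: Sub 3 7 6; Sub 3 2 3; Sub 3 2 3])
  (Seq emit
  (Seq (Block [:: Sub 3 6 7; Sub 4 7 6; Add 3 3 4; Const 4 0])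
  (Seq (doubles e)
  (Seq emit
  (Seq (Block [:: Const 3 1; Const 6 0; Const 7 0])
       emit))))).

Definition emit_entry (e : nat) (b : seq instr) : cmd :=
  Seq (scan b) (finish_entry e).

(* Register i, initially 0, counts up to the value of register b, and register d
   holds their difference. *)
Definition for_loop (i d b : nat) (c : cmd) : cmd :=
  Seq (Block [:: Add d b 1])
  (Seq (While d (Seq c (Block [:: Add i i 2; Sub d b i])))
       (Block [:: Const i 0])).

(** [F k] is the state before turn [k], and [G k] the one after its body, before the counter
    moves. *)
Lemma runs_for_loop (i d b n t : nat) (c : cmd) (s s' : state) (F G : nat -> state) :
  step s (Add d b 1) = F 0 -> step (F n) (Const i 0) = s' ->
  (forall k, nth 0 (F k).1 d = n - k) -> (forall k, nth 0 (F k).1 1 = 0) ->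
  (forall k, runs c (F k) t (G k)) ->
  (forall k, foldl step (G k) [:: Add i i 2; Sub d b i] = F k.+1) ->
  runs (for_loop i d b c) s (n * (t + 4) + 3) s'.
Proof.
move=> sF Fs' Fd F1 Hc GF.
apply: (@runs_le _ _ _ (1 + (n * (t + 2 + 2) + 1 + 1))); first by lia.
apply: (@runs_seq _ _ _ (F 0)); first exact: runs_block_eq.
apply: (@runs_seq _ _ _ (F n)); last exact: runs_block_eq.
apply: (@runs_while _ _ F) => [k lek|//|k _]; first by rewrite Fd; lia.
by apply: runs_seq (Hc k) _; exact: runs_block_eq.
Qed.

Definition for_j : cmd -> cmd := for_loop 18 19 24.
Definition for_i2 : cmd -> cmd := for_loop 20 21 25.
Definition for_i1 : cmd -> cmd := for_loop 22 23 25.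

Definition emit_zero : cmd :=
  Seq emit (Seq emit (Seq (Block [:: Const 3 1]) emit)).

(** Brings the registers left by [decode] into the layout of the emitter; $(2n)^2$ is computed by
    repeated addition. *)
Definition start : cmd :=
  Seq (Block [:: Add 27 9 2; Const 4 0; Const 7 0; Fetch 24 9; Const 9 0;
                 Add 25 24 24; Add 26 0 1; Add 3 24 1])
  (Seq emit
  (Seq (Block [:: Add 19 25 1])
  (Seq (While 19 (Block [:: Add 3 3 25; Sub 19 19 2]))
       emit))).

(** The last instruction stores the output length where the relocated program expects its register
    0. *)
Definition reduction (e : nat) : cmd :=
  Seq decode
  (Seq start
  (Seq (for_i1 (for_i2 (for_j (emit_entry e weight_block))))
  (Seq (for_i1 (for_i2 (emit_entry e bias_block)))
  (Seq (for_i1 (for_i2 emit_zero))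
       (Block [:: Sub 29 0 26]))))).

Definition entry_code (e a b : nat) : seq nat :=
  [:: nat_of_bool (a < b); (a - b + (b - a)) * 2 ^ e; 1].

Definition clause_sum (f : nclause -> nat) (cs : seq nclause) : nat := sumn (map f cs).

Definition rows (n : nat) (g : nat -> nat -> seq nat) : seq nat :=
  flatten [seq flatten [seq g i1 i2 | i2 <- iota 0 (n + n)] | i1 <- iota 0 (n + n)].

Definition weight_row (e n : nat) (cs : seq nclause) (i1 i2 : nat) : seq nat :=
  flatten [seq entry_code e (clause_sum (weight_pos i1 i2 j) cs)
                            (clause_sum (weight_neg i1 i2 j) cs) | j <- iota 0 n].

Definition bias_row (e : nat) (cs : seq nclause) (i1 i2 : nat) : seq nat :=
  entry_code e (clause_sum (bias_pos i1 i2) cs) (clause_sum (bias_neg i1 i2) cs).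

Definition network_numbers (e n : nat) (cs : seq nclause) : seq nat :=
  [:: n, (n + n) * (n + n) & rows n (weight_row e n cs) ++
    rows n (bias_row e cs) ++ rows n (fun _ _ => [:: 0; 0; 1])].

(** With three literals per clause, an entry is at most $3m2^e$ in absolute value. *)
Definition entry_time (e m : nat) : nat := 14 * (3 * m * 2 ^ e) + 72 * m + e + 63.

Definition rows_time (n t : nat) : nat :=
  (n + n) * ((n + n) * (t + 4) + 3 + 4) + 3.

Definition reduction_time (e n m l : nat) : nat :=
  (l * 16 + 5) + (14 * (n + 2 * n + (n + n) * (n + n)) + 24 +
  (rows_time n (n * (entry_time e m + 4) + 3) +
  (rows_time n (entry_time e m) + (rows_time n 36 + 1)))).

Lemma clause_sum_le3 (f : nclause -> nat) (cs : seq nclause) :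
  (forall c, f c <= 3) -> clause_sum f cs <= 3 * size cs.
Proof.
by move=> f3; rewrite /clause_sum; elim: cs => //= c s IH; have := f3 c; lia.
Qed.

Lemma weight_pos_le3 (i1 i2 j : nat) (c : nclause) : weight_pos i1 i2 j c <= 3.
Proof. by case: c => [[l1 l2] l3]; rewrite /weight_pos; do 3!case: (_ && _). Qed.

Lemma weight_neg_le3 (i1 i2 j : nat) (c : nclause) : weight_neg i1 i2 j c <= 3.
Proof. by case: c => [[l1 l2] l3]; rewrite /weight_neg; do 3!case: (_ && _). Qed.

Lemma bias_pos_le3 (i1 i2 : nat) (c : nclause) : bias_pos i1 i2 c <= 3.
Proof. by rewrite /bias_pos; case: matches. Qed.

Lemma bias_neg_le3 (i1 i2 : nat) (c : nclause) : bias_neg i1 i2 c <= 3.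
Proof. by case: c => [[l1 l2] l3]; rewrite /bias_neg; do 3!case: (_ && _). Qed.

(** * Execution of the emitter *)

Section Emitter.

Variables (n : nat) (cs : seq nclause) (w : seq nat).

Definition formula_numbers : seq nat := n :: flatten (map nclause_code cs).

Let base := w ++ formula_numbers.

Let mem (q : seq nat) := base ++ encode_nats q.

(** The invariant of the emitter: [q] lists the numbers emitted so far, and register 0 points just
    behind them. *)
Let st (q : seq nat) (k a b p d j dj i2 d2 i1 d1 : nat) : state :=
  (registers (size (mem q)) k a b p d j dj i2 d2 i1 d1 n (size base) (size w).+1,
   mem q).

Lemma size_clauses (s : seq nclause) : size (flatten (map nclause_code s)) = 6 * size s.
Proof. by elim: s => [|[[l1 l2] l3] s IH] //=; rewrite IH; lia. Qed.

Lemma size_base : size base = (size w).+1 + 6 * size cs.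
Proof. by rewrite size_cat /= size_clauses; lia. Qed.

Lemma nth_clause (c0 : nclause) (s : seq nclause) (k r : nat) :
  k < size s -> r < 6 ->
  nth 0 (flatten (map nclause_code s)) (6 * k + r) =
  nth 0 (nclause_code (nth c0 s k)) r.
Proof.
move=> + r6; elim: s k => //= c s IH [|k] lek; rewrite nth_cat.
  by case: c => [[l1 l2] l3]; rewrite r6.
have -> : size (nclause_code c) = 6 by case: c => [[? ?] ?].
rewrite ifF; last by lia.
by rewrite (_ : 6 * k.+1 + r - 6 = 6 * k + r) ?IH //; lia.
Qed.

Lemma runs_emit_st (q : seq nat) (k a b p d j dj i2 d2 i1 d1 : nat) :
  runs emit (st q k a b p d j dj i2 d2 i1 d1) (14 * k + 7)
    (st (rcons q k) 0 a b p d j dj i2 d2 i1 d1).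
Proof.
rewrite /st /registers /mem encode_nats_rcons catA; exact: runs_emit.
Qed.

Lemma runs_scan (b : seq instr) (f g : nat -> nat -> nat -> nclause -> nat)
    (q : seq nat) (j dj i2 d2 i1 d1 : nat) :
  block_spec b f g -> all straight b -> size b <= 70 ->
  runs (scan b) (st q 0 0 0 0 0 j dj i2 d2 i1 d1) (72 * size cs + 4)
    (st q 0 (clause_sum (f i1 i2 j) cs) (clause_sum (g i1 i2 j) cs) 0 0
       j dj i2 d2 i1 d1).
Proof.
move=> Hb sb szb.
pose F k := st q 0
  (clause_sum (f i1 i2 j) (take k cs)) (clause_sum (g i1 i2 j) (take k cs))
  ((size w).+1 + 6 * k) (size base - ((size w).+1 + 6 * k)) j dj i2 d2 i1 d1.
apply: (@runs_le _ _ _ (2 + (size cs * (70 + 2) + 1 + 1))); first by lia.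
apply: (@runs_seq _ _ _ (F 0)).
  by apply: runs_block_eq; rewrite //= /F take0 /= muln0 addn0.
apply: (@runs_seq _ _ _ (F (size cs))); last first.
  apply: runs_block_eq => //; rewrite /F take_size.
  by rewrite (_ : size base - _ = 0) ?size_base ?subnn.
apply: (@runs_while _ _ F 70) => [k lek|//|k ltk].
  by rewrite /= size_base; lia.
have c0 : nclause by case: (cs) ltk.
apply: runs_block_eq => //.
rewrite /F (take_nth c0 ltk) /clause_sum !map_rcons !sumn_rcons mulnS.
rewrite (addnC 6) addnA; apply: Hb => r r6.
(* The cell read lies in [base], behind [w] and behind the one cell holding [n]. *)
rewrite /mem nth_cat size_base ifT; last by lia.
rewrite nth_cat ifF; last by lia.
rewrite -(nth_clause c0 ltk r6) (_ : _ - size w = (6 * k + r).+1) //; lia.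
Qed.

Lemma runs_doubles (e : nat) (q : seq nat) (k a b p d j dj i2 d2 i1 d1 : nat) :
  runs (doubles e) (st q k a b p d j dj i2 d2 i1 d1) e
    (st q (k * 2 ^ e) a b p d j dj i2 d2 i1 d1).
Proof.
elim: e k => [|e IH] k; first by rewrite muln1; exact: runs_block.
rewrite -add1n; apply: (@runs_seq _ _ _ (st q (k + k) a b p d j dj i2 d2 i1 d1)).
  exact: runs_block_eq.
by rewrite (_ : k * _ = (k + k) * 2 ^ e) // expnS; lia.
Qed.

Lemma runs_emit_entry (e : nat) (b : seq instr)
    (f g : nat -> nat -> nat -> nclause -> nat) (q : seq nat)
    (j dj i2 d2 i1 d1 : nat) :
  block_spec b f g -> all straight b -> size b <= 70 ->
  (forall c, f i1 i2 j c <= 3) -> (forall c, g i1 i2 j c <= 3) ->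
  runs (emit_entry e b) (st q 0 0 0 0 0 j dj i2 d2 i1 d1) (entry_time e (size cs))
    (st (q ++ entry_code e (clause_sum (f i1 i2 j) cs) (clause_sum (g i1 i2 j) cs))
       0 0 0 0 0 j dj i2 d2 i1 d1).
Proof.
move=> Hb sb szb /(clause_sum_le3 cs) + /(clause_sum_le3 cs).
set x := clause_sum (f _ _ _) _; set y := clause_sum (g _ _ _) _ => x3 y3.
rewrite -[q ++ _](_ : rcons (rcons (rcons q (x < y))
  ((x - y + (y - x)) * 2 ^ e)) 1 = _);
  last by rewrite -!cats1 -!catA.
apply: (@runs_le _ _ _ (72 * size cs + 4 + (3 + (14 * (x < y) + 7 +
  (4 + (e + (14 * ((x - y + (y - x)) * 2 ^ e) + 7 + (3 + (14 * 1 + 7))))))))).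
  rewrite /entry_time.
  have : (x - y + (y - x)) * 2 ^ e <= 3 * size cs * 2 ^ e by rewrite leq_mul2r; lia.
  by case: (x < y); lia.
apply: (runs_seq (runs_scan q j dj i2 d2 i1 d1 Hb sb szb)).
apply: (@runs_seq _ _ _ (st q (x < y) x y 0 0 j dj i2 d2 i1 d1)).
  apply: runs_block_eq => //; rewrite /st; eval_block.
  by rewrite (_ : 1 - (1 - (y - x)) = (x < y)) //; lia.
apply: runs_seq; first exact: runs_emit_st.
apply: (@runs_seq _ _ _
  (st (rcons q (x < y)) (x - y + (y - x)) x y 0 0 j dj i2 d2 i1 d1)).
  exact: runs_block_eq.
apply: runs_seq; first exact: runs_doubles.
apply: runs_seq; first exact: runs_emit_st.
apply: (@runs_seq _ _ _ (st (rcons (rcons q (x < y))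
  ((x - y + (y - x)) * 2 ^ e)) 1 0 0 0 0 j dj i2 d2 i1 d1)).
  exact: runs_block_eq.
exact: runs_emit_st.
Qed.

Lemma flatten_map_iotaS (g : nat -> seq nat) (k : nat) :
  flatten (map g (iota 0 k.+1)) = flatten (map g (iota 0 k)) ++ g k.
Proof. by rewrite -addn1 iotaD map_cat flatten_cat /= cats0. Qed.

Lemma runs_for_j (c : cmd) (g : nat -> seq nat) (t : nat) (q : seq nat)
    (i2 d2 i1 d1 : nat) :
  (forall q' j dj, runs c (st q' 0 0 0 0 0 j dj i2 d2 i1 d1) t
     (st (q' ++ g j) 0 0 0 0 0 j dj i2 d2 i1 d1)) ->
  runs (for_j c) (st q 0 0 0 0 0 0 0 i2 d2 i1 d1) (n * (t + 4) + 3)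
    (st (q ++ flatten (map g (iota 0 n))) 0 0 0 0 0 0 0 i2 d2 i1 d1).
Proof.
move=> Hc.
(* Two indices, since the body has already emitted piece [k] while the counter is still [k]. *)
pose F h k := st (q ++ flatten (map g (iota 0 h))) 0 0 0 0 0 k (n - k) i2 d2 i1 d1.
apply: (@runs_for_loop _ _ _ _ _ _ _ _ (fun k => F k k)
  (fun k => F k.+1 k)) => // [||k|k].
- by rewrite /F /= cats0 subn0 addn0.
- by rewrite /F subnn.
- by rewrite /F flatten_map_iotaS catA; exact: Hc.
- by rewrite /F -(addn1 k).
Qed.

Lemma runs_for_i2 (c : cmd) (g : nat -> seq nat) (t : nat) (q : seq nat)
    (i1 d1 : nat) :
  (forall q' i2 d2, runs c (st q' 0 0 0 0 0 0 0 i2 d2 i1 d1) t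
     (st (q' ++ g i2) 0 0 0 0 0 0 0 i2 d2 i1 d1)) ->
  runs (for_i2 c) (st q 0 0 0 0 0 0 0 0 0 i1 d1) ((n + n) * (t + 4) + 3)
    (st (q ++ flatten (map g (iota 0 (n + n)))) 0 0 0 0 0 0 0 0 0 i1 d1).
Proof.
move=> Hc.
pose F h k := st (q ++ flatten (map g (iota 0 h))) 0 0 0 0 0 0 0 k (n + n - k) i1 d1.
apply: (@runs_for_loop _ _ _ _ _ _ _ _ (fun k => F k k)
  (fun k => F k.+1 k)) => // [||k|k].
- by rewrite /F /= cats0 subn0 addn0.
- by rewrite /F subnn.
- by rewrite /F flatten_map_iotaS catA; exact: Hc.
- by rewrite /F -(addn1 k).
Qed.

Lemma runs_for_i1 (c : cmd) (g : nat -> seq nat) (t : nat) (q : seq nat) :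
  (forall q' i1 d1, runs c (st q' 0 0 0 0 0 0 0 0 0 i1 d1) t
     (st (q' ++ g i1) 0 0 0 0 0 0 0 0 0 i1 d1)) ->
  runs (for_i1 c) (st q 0 0 0 0 0 0 0 0 0 0 0) ((n + n) * (t + 4) + 3)
    (st (q ++ flatten (map g (iota 0 (n + n)))) 0 0 0 0 0 0 0 0 0 0 0).
Proof.
move=> Hc.
pose F h k := st (q ++ flatten (map g (iota 0 h))) 0 0 0 0 0 0 0 0 0 k (n + n - k).
apply: (@runs_for_loop _ _ _ _ _ _ _ _ (fun k => F k k)
  (fun k => F k.+1 k)) => // [||k|k].
- by rewrite /F /= cats0 subn0 addn0.
- by rewrite /F subnn.
- by rewrite /F flatten_map_iotaS catA; exact: Hc.
- by rewrite /F -(addn1 k).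
Qed.

Lemma runs_rows (c : cmd) (g : nat -> nat -> seq nat) (t : nat) (q : seq nat) :
  (forall q' i2 d2 i1 d1, runs c (st q' 0 0 0 0 0 0 0 i2 d2 i1 d1) t
     (st (q' ++ g i1 i2) 0 0 0 0 0 0 0 i2 d2 i1 d1)) ->
  runs (for_i1 (for_i2 c)) (st q 0 0 0 0 0 0 0 0 0 0 0) (rows_time n t)
    (st (q ++ rows n g) 0 0 0 0 0 0 0 0 0 0 0).
Proof. by move=> Hc; apply: runs_for_i1 => q' i1 d1; apply: runs_for_i2. Qed.

Lemma runs_emit_zero (q : seq nat) (i2 d2 i1 d1 : nat) :
  runs emit_zero (st q 0 0 0 0 0 0 0 i2 d2 i1 d1) 36
    (st (q ++ [:: 0; 0; 1]) 0 0 0 0 0 0 0 i2 d2 i1 d1).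
Proof.
rewrite -[q ++ _](_ : rcons (rcons (rcons q 0) 0) 1 = _);
  last by rewrite -!cats1 -!catA.
apply: (@runs_seq _ _ _ _ _ 7 29); first exact: runs_emit_st.
apply: (@runs_seq _ _ _ _ _ 7 22); first exact: runs_emit_st.
apply: (@runs_seq _ _ _ (st (rcons (rcons q 0) 0) 1 0 0 0 0 0 0 i2 d2 i1 d1) _ 1 21).
  exact: runs_block_eq.
exact: runs_emit_st.
Qed.

Lemma runs_start :
  runs start ([:: size base; 0; 1; 0; 1; 0; 0; size w; 0; size w], base)
    (14 * (n + 2 * n + (n + n) * (n + n)) + 24)
    (st [:: n; (n + n) * (n + n)] 0 0 0 0 0 0 0 0 0 0 0).
Proof.
pose F k := st [:: n] (k * (n + n)) 0 0 0 0 0 (n + n - k) 0 0 0 0.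
apply: (@runs_le _ _ _ (8 + (14 * n + 7 + (1 + ((n + n) * (2 + 2) + 1 +
  (14 * ((n + n) * (n + n)) + 7)))))); first by lia.
apply: (@runs_seq _ _ _ (st [::] n 0 0 0 0 0 0 0 0 0 0)).
  apply: runs_block_eq => //; rewrite /st /mem cats0.
  have : nth 0 base (size w) = n by rewrite nth_cat ltnn subnn.
  by eval_block => ->; rewrite !addn0 addn1.
apply: runs_seq; first exact: runs_emit_st.
apply: (@runs_seq _ _ _ (F 0)).
  by apply: runs_block_eq; rewrite //= /F mul0n subn0 addn0.
apply: (@runs_seq _ _ _ (F (n + n))); last first.
  rewrite /F subnn; exact: runs_emit_st.
apply: (@runs_while _ _ F) => [k lek|//|k ltk]; first by rewrite /=; lia.
by apply: runs_block_eq => //; rewrite /F mulSnr subnS -subn1.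
Qed.

(** [registers] ends at register 27, and writing register 29 pads register 28 with 0. Seen from
    register 29 and address [size base], the final state is the initial one on [o]. *)
Lemma runs_reduction (e : nat) :
  let o := encode_nats (network_numbers e n cs) in
  w = encode_nats formula_numbers ->
  runs (reduction e) ([:: size w], w) (reduction_time e n (size cs) (size w))
    (rcons (rcons (registers (size (base ++ o)) 0 0 0 0 0 0 0 0 0 0 0 n
       (size base) (size w).+1) 0) (size o), base ++ o).
Proof.
move=> o wE.
apply: (@runs_seq _ _ _ ([:: size base; 0; 1; 0; 1; 0; 0; size w; 0; size w], base)).
  by have := runs_decode formula_numbers; rewrite /= -wE.
apply: runs_seq; first exact: runs_start.
apply: runs_seq.
  apply: (@runs_rows _ (weight_row e n cs)) => q i2 d2 i1 d1.
  apply: runs_for_j => q' j dj.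
  apply: (runs_emit_entry e q' dj d2 d1 weight_blockP) => //.
    exact: weight_pos_le3.
  exact: weight_neg_le3.
apply: runs_seq.
  apply: (@runs_rows _ (bias_row e cs)) => q i2 d2 i1 d1.
  apply: (@runs_emit_entry e _ _ _ q 0 0 i2 d2 i1 d1 bias_blockP) => //.
    exact: bias_pos_le3.
  exact: bias_neg_le3.
apply: runs_seq.
  by apply: (@runs_rows _ (fun _ _ => [:: 0; 0; 1])) => *; exact: runs_emit_zero.
apply: runs_block_eq => //; rewrite /st /mem.
rewrite (_ : encode_nats _ = o); last by rewrite -!catA.
have : size (base ++ o) - size base = size o by rewrite size_cat addKn.
by eval_block => ->.
Qed.

End Emitter.

(** * Correctness of the reduction *)

Local Open Scope ring_scope.

Definition nliteral (n : nat) (l : 'I_n * bool) : literal := (nat_of_ord l.1, l.2).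

Definition nclause_of (n : nat) (c : clause3 n) : nclause :=
  (nliteral (tnth c (@Ordinal 3 0 isT)), nliteral (tnth c (@Ordinal 3 1 isT)),
   nliteral (tnth c (@Ordinal 3 2 isT))).

Lemma clause3P (n : nat) (c : clause3 n) : exists l1 l2 l3,
  tval c = [:: l1; l2; l3] /\ nclause_of c = (nliteral l1, nliteral l2, nliteral l3).
Proof.
by case: c => -[|l1 [|l2 [|l3 []]]] //= sc; exists l1, l2, l3.
Qed.

Definition nclauses (phi : formula3) : seq nclause :=
  map (@nclause_of (nvars phi)) (clauses phi).

Lemma formula3_codeE (phi : formula3) :
  formula3_code phi = formula_numbers (nvars phi) (nclauses phi).
Proof.
rewrite /formula3_code /formula_numbers /nclauses -map_comp; congr (_ :: flatten _).
apply: eq_map => c; have [l1 [l2 [l3 [c_eq c'_eq]]]] := clause3P c.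
by rewrite [RHS]/comp c_eq c'_eq.
Qed.

Definition entry (e a b : nat) : rat := ((a%:Z - b%:Z) * (2 ^ e)%N%:Z)%:~R.

Lemma rat_code_entry (e a b : nat) : rat_code (entry e a b) = entry_code e a b.
Proof.
have e0 : (0 < 2 ^ e)%N by rewrite expn_gt0.
rewrite /rat_code /entry_code /entry ltrz0 numq_int denq_int abszM.
congr [:: nat_of_bool _; _; _].
  by rewrite pmulr_llt0 ?subr_lt0.
by congr muln; lia.
Qed.

(** Row [i] belongs to the pair of literals numbered by the quotient and the remainder of [i] by
    $2n$. *)
Definition reduced (e : nat) (phi : formula3) : inversion_instance :=
  let n := nvars phi in
  let k := (n + n)%N in
  @InversionInstance n (k * k)%N
    (\matrix_(i, j) entry e (clause_sum (weight_pos (i %/ k) (i %% k) j) (nclauses phi))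
                            (clause_sum (weight_neg (i %/ k) (i %% k) j) (nclauses phi)))
    (\col_i entry e (clause_sum (bias_pos (i %/ k) (i %% k)) (nclauses phi))
                    (clause_sum (bias_neg (i %/ k) (i %% k)) (nclauses phi)))
    0.

Lemma flatten_flatten (T : Type) (s : seq (seq (seq T))) :
  flatten (flatten s) = flatten (map flatten s).
Proof. by elim: s => //= x s <-; rewrite flatten_cat. Qed.

Lemma map_enum_ord (T : Type) (f : nat -> T) (n : nat) :
  [seq f i | i : 'I_n <- enum 'I_n] = map f (iota 0 n).
Proof. by rewrite -val_enum_ord -map_comp. Qed.

(** Matches the order of matrix rows with that of the nested loops of the machine. *)
Lemma map_iota_mul (T : Type) (g : nat -> nat -> T) (a k : nat) :
  [seq g (i %/ k)%N (i %% k)%N | i <- iota 0 (a * k)] =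
  flatten [seq [seq g i1 i2 | i2 <- iota 0 k] | i1 <- iota 0 a].
Proof.
elim: a => [|a IH]; first by rewrite mul0n.
rewrite -addn1 mulnDl mul1n !iotaD !map_cat flatten_cat IH /= cats0 !add0n.
congr cat; rewrite -{1}[(a * k)%N]addn0 iotaDl -map_comp.
apply/eq_in_map => i; rewrite mem_iota add0n => /= ik.
by rewrite divnMDl ?modnMDl ?divn_small ?addn0 ?modn_small //; exact: leq_ltn_trans ik.
Qed.

Lemma mx_code_rows (n q : nat) (g : nat -> nat -> nat -> seq nat)
    (A : 'M[rat]_((n + n) * (n + n), q)) :
  (forall i j, rat_code (A i j) = g (i %/ (n + n))%N (i %% (n + n))%N j) ->
  mx_code A = rows n (fun i1 i2 => flatten [seq g i1 i2 j | j <- iota 0 q]).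
Proof.
move=> Ag; rewrite /mx_code /rows flatten_flatten -map_comp.
pose h i1 i2 := flatten [seq g i1 i2 j | j <- iota 0 q].
pose h' i := h (i %/ (n + n))%N (i %% (n + n))%N.
rewrite (eq_map (g := fun i : 'I_((n + n) * (n + n)) => h' i)).
  rewrite (map_enum_ord h').
  by rewrite map_iota_mul flatten_flatten -map_comp.
move=> i /=; rewrite /h' /h -map_enum_ord; congr flatten.
by apply: eq_map => j.
Qed.

Lemma inversion_code_reduced (e : nat) (phi : formula3) :
  inversion_code (reduced e phi) = network_numbers e (nvars phi) (nclauses phi).
Proof.
rewrite /inversion_code /network_numbers /=; congr [:: _, _ & _].
congr (_ ++ (_ ++ _)).
- by apply: mx_code_rows => i j; rewrite mxE rat_code_entry.
- rewrite (mx_code_rows (g := fun i1 i2 _ => bias_row e (nclauses phi) i1 i2)).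
    by congr rows; apply: funext => i1; apply: funext => i2; rewrite /= cats0.
  by move=> i j; rewrite mxE rat_code_entry.
- rewrite (mx_code_rows (g := fun _ _ _ => [:: 0; 0; 1]%N)) //.
  by move=> i j; rewrite mxE.
Qed.

Lemma clause_sum_cons (f : nclause -> nat) (c : nclause) (s : seq nclause) :
  clause_sum f (c :: s) = (f c + clause_sum f s)%N.
Proof. by []. Qed.

(** * Values of the neurons, and the equivalence with satisfiability *)

Section Correctness.

Variables (R : realType) (e : nat) (phi : formula3).

Let n := nvars phi.

Lemma ratr_entry (a b : nat) :
  ratr (entry e a b) = (a%:R - b%:R) * (2 ^ e)%:R :> R.
Proof. by rewrite ratr_int rmorphM rmorphB /= !pmulrn. Qed.

Definition truth (z : 'cV[R]_n) (l : 'I_n * bool) : R := ((z l.1 0 == 1) == l.2)%:R.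

(** Only the variable of [l] contributes: $-z_v$ for a plain literal, and $z_v=1-(1-z_v)$ for a
    negated one. *)
Lemma literal_value (z : 'cV[R]_n) (m : bool) (l : 'I_n * bool) :
  binary z ->
  \sum_(j < n) (((m && (val l.1 == val j)) && ~~ l.2)%:R -
                ((m && (val l.1 == val j)) && l.2)%:R) * z j 0 =
  (m && ~~ l.2)%:R - m%:R * truth z l.
Proof.
case: l => v s zb; rewrite (bigD1 v) //= big1 => [|j jv]; last first.
  by rewrite eq_sym (negbTE jv : val j == val v = false) andbF subrr mul0r.
rewrite eqxx andbT addr0 /truth /=.
have [->|->] := zb v; rewrite ?eqxx ?[0 == 1]eq_sym ?oner_eq0.
  by rewrite mulr0; case: m; case: s => /=; rewrite ?mulr0 ?mul0r ?mulr1 ?subrr.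
by case: m; case: s => /=; rewrite ?mulr0 ?mul0r ?mulr1 ?subr0 ?subrr ?sub0r.
Qed.

(** Summing over the three literals, the constants of the negated ones cancel against [bias_neg]. *)
Lemma clause_value (z : 'cV[R]_n) (i1 i2 : nat) (c : clause3 n) :
  binary z ->
  \sum_(j < n) ((weight_pos i1 i2 j (nclause_of c))%:R -
                (weight_neg i1 i2 j (nclause_of c))%:R) * z j 0 +
    ((bias_pos i1 i2 (nclause_of c))%:R - (bias_neg i1 i2 (nclause_of c))%:R) =
  (matches i1 i2 (nclause_of c))%:R * (1 - \sum_(l <- c) truth z l).
Proof.
move=> zb; have [l1 [l2 [l3 [-> ->]]]] := clause3P c.
rewrite /weight_pos /weight_neg /bias_pos /bias_neg !big_cons big_nil.
set m := matches _ _ _.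
have := literal_value m l3 zb; have := literal_value m l2 zb.
have := literal_value m l1 zb; rewrite /nliteral /=.
set S1 := \sum_(j < n) _ => E1; set S2 := \sum_(j < n) _ => E2.
set S3 := \sum_(j < n) _ => E3; set S := \sum_(j < n) _.
have -> : S = S1 + S2 + S3.
  by rewrite -!big_split; apply: eq_bigr => j _ /=; rewrite !natrD; ring.
rewrite E1 E2 E3 !natrD; ring.
Qed.

Lemma row_value (z : 'cV[R]_n) (i : 'I_((n + n) * (n + n))) :
  binary z ->
  (map_mx ratr (weights (reduced e phi)) *m z +
   map_mx ratr (bias (reduced e phi))) i 0 =
  (2 ^ e)%:R * \sum_(c <- clauses phi)
    (matches (i %/ (n + n)) (i %% (n + n)) (nclause_of c))%:R *
    (1 - \sum_(l <- c) truth z l).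
Proof.
move=> zb; rewrite !mxE ratr_entry.
under eq_bigr => j _ do rewrite !mxE ratr_entry mulrAC.
rewrite -mulr_suml -mulrDl mulrC; congr (_ * _); rewrite /nclauses.
elim: (clauses phi) => [|c s IH].
  rewrite big_nil /clause_sum /= subrr addr0.
  by rewrite big1 // => j _; rewrite mul0r.
rewrite big_cons -IH -clause_value // !map_cons.
set S1 := (X in _ = X + _ + _); set S2 := (X in _ = _ + (X + _)).
set S := (X in X + _ = _); have -> : S = S1 + S2.
  rewrite -big_split; apply: eq_bigr => j _.
  by rewrite !clause_sum_cons !natrD /=; ring.
by rewrite !clause_sum_cons !natrD; ring.
Qed.

(** Parity recovers the sign, and halving the variable. *)
Lemma literal_code_inj (l1 l2 : 'I_n * bool) :
  (l1.1 + l1.1 + l1.2 = l2.1 + l2.1 + l2.2)%N -> l1 = l2.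
Proof.
case: l1 l2 => [v1 s1] [v2 s2] /= eq12.
have s12 : s1 = s2 by move: eq12; case: s1; case: s2 => //=; lia.
by congr (_, _) => //; apply: val_inj => /=; move: eq12; rewrite s12; lia.
Qed.

(* A failing clause contributes 1 to the row indexed by its first two literals,
   and no clause with the same first two literals contributes less than 0. *)
Lemma unsat_row (z : 'cV[R]_n) (c : clause3 n) :
  c \in clauses phi -> ~~ has (fun l => (z l.1 0 == 1) == l.2) c ->
  exists i : 'I_((n + n) * (n + n)),
  1 <= \sum_(c' <- clauses phi)
    (matches (i %/ (n + n)) (i %% (n + n)) (nclause_of c'))%:R *
    (1 - \sum_(l <- c') truth z l).
Proof.
have [l1 [l2 [l3 [c_eq c'_eq]]]] := clause3P c.
move=> c_in; rewrite c_eq [has _ _]/= orbF !negb_or => /and3P[l1F l2F l3F].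
pose k (l : 'I_n * bool) := (l.1 + l.1 + l.2)%N.
have k_lt l : (k l < n + n)%N by rewrite /k; have := ltn_ord l.1; case: (l.2); lia.
have i_lt : (k l1 * (n + n) + k l2 < (n + n) * (n + n))%N.
  have := k_lt l1; have := k_lt l2; nia.
have nn : (0 < n + n)%N by apply: leq_ltn_trans (k_lt l1).
have i_div : (Ordinal i_lt %/ (n + n))%N = k l1.
  by rewrite /= divnMDl // divn_small // addn0.
have i_mod : (Ordinal i_lt %% (n + n))%N = k l2.
  by rewrite /= modnMDl modn_small.
exists (Ordinal i_lt); rewrite i_div i_mod.
have F (l : 'I_n * bool) : (z l.1 0 == 1) != l.2 -> truth z l = 0.
  by rewrite /truth => /negbTE ->.
have m_c : matches (k l1) (k l2) (nclause_of c) by rewrite c'_eq /= !eqxx.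
rewrite (big_rem c) // m_c c_eq !big_cons big_nil !F // mul1r.
rewrite !addr0 subr0 lerDl; apply: sumr_ge0 => c2 _.
have [l1' [l2' [l3' [-> ->]]]] := clause3P c2.
(* A clause of the same group starts with the same two failing literals, so at most its third
   literal holds. *)
case: (boolP (matches _ _ _)) => [/andP[/eqP/literal_code_inj -> ]|]; last first.
  by rewrite mul0r.
move=> /eqP/literal_code_inj ->; rewrite mul1r !big_cons big_nil (F l1) // (F l2) // !add0r.
by rewrite addr0 subr_ge0 /truth lern1 leq_b1.
Qed.

(** The $p$-th power of the entry is one term of the nonnegative sum under the root. *)
Lemma lpnorm_le (p m : nat) (v : 'cV[R]_m) (delta : R) (i : 'I_m) :
  (0 < p)%N -> 0 <= delta -> lpnorm p v <= delta -> `|v i 0| <= delta.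
Proof.
move=> p0 d0 le_d.
have p0' : p%:R != 0 :> R by rewrite pnatr_eq0 -lt0n.
have S0 : 0 <= \sum_(j < m) `|v j 0| ^+ p by apply: sumr_ge0 => j _; rewrite exprn_ge0.
rewrite -(@ler_pXn2r _ p) ?nnegrE //.
have -> : delta ^+ p = delta `^ p%:R by rewrite powR_mulrn.
apply: le_trans (ge0_ler_powR (ler0n R p) _ _ le_d); rewrite ?nnegrE ?powR_ge0 //.
rewrite /lpnorm -powRrM mulVf // powRr1 // (bigD1 i) //= lerDl.
by apply: sumr_ge0 => j _; rewrite exprn_ge0.
Qed.

Lemma approx_invertible_reduced (p : nat) (delta : R) :
  (0 < p)%N -> 0 <= delta -> delta < (2 ^ e)%:R ->
  approx_invertible p delta (reduced e phi) <-> satisfiable phi.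
Proof.
move=> p0 d0 d_lt; have e_gt0 : 0 < (2 ^ e)%:R :> R by rewrite ltr0n expn_gt0.
split=> [[z [zb le_d]]|[a sat_a]].
  exists (fun i => z i 0 == 1); apply/allP => c c_in; apply: contraT => c_unsat.
  (* The row of the failing clause outputs at least $2^e>\delta$, against the bound on the norm. *)
  have [i] := unsat_row c_in c_unsat; rewrite leNgt => /negP[].
  rewrite -(ltr_pM2l e_gt0) mulr1 -row_value //; apply: le_lt_trans d_lt.
  apply: le_trans (lpnorm_le i p0 d0 le_d).
  rewrite /network /relu_layer /relu.
  move: (_ *m _ + _) => u; rewrite !mxE rmorph0 subr0.
  by apply: le_trans (ler_norm _); rewrite le_max lexx.
pose z : 'cV[R]_n := \col_i (a i)%:R.
have zb : binary z by move=> i; rewrite mxE; case: (a i); [right|left].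
(* Here the output is exactly 0, because no pre-activation is positive; $0^{1/p}=0$ as $1/p\neq
   0$. *)
exists z; split=> //; rewrite /lpnorm big1 ?powR0 //.
  by rewrite invr_eq0 pnatr_eq0 -lt0n.
move=> i _; rewrite /network /relu_layer mxE [map_mx relu _ _ _]mxE /relu.
rewrite row_value // !mxE rmorph0 subr0.
rewrite (max_idPr _) ?normr0 ?expr0n ?gtn_eqF //.
rewrite pmulr_rle0 // big_seq; apply: sumr_le0 => c c_in.
apply: mulr_ge0_le0 => //; rewrite subr_le0.
have /hasP[l l_in /eqP al] := allP sat_a c c_in.
rewrite (big_rem l) //= {1}/truth mxE al.
have -> : (((l.2)%:R == 1 :> R) == l.2) = true.
  by rewrite pnatr_eq1; case: (l.2).
by rewrite lerDl; apply: sumr_ge0 => l' _; exact: ler0n.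
Qed.

End Correctness.

(** * Running times *)

Local Open Scope nat_scope.

Lemma size_encode_nat (k : nat) : size (encode_nat k) <= k.+1.
Proof. by rewrite size_rcons size_map size_iota ltnS up_log_min // ltn_expl. Qed.

Lemma size_le_encode_nats (s : seq nat) : size s <= size (encode_nats s).
Proof.
elim: s => //= k s IH.
by rewrite /encode_nats /= size_cat size_rcons addSn ltnS (leq_trans IH) // leq_addl.
Qed.

(** A crude bound on the binary length, additive under concatenation and sufficient for numbers of
    polynomial size. *)
Definition unary_size (s : seq nat) : nat := sumn (map succn s).

Lemma unary_size_cat (s1 s2 : seq nat) :
  unary_size (s1 ++ s2) = unary_size s1 + unary_size s2.
Proof. by rewrite /unary_size map_cat sumn_cat. Qed.

Lemma size_encode_nats (s : seq nat) : size (encode_nats s) <= unary_size s.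
Proof.
elim: s => //= k s IH; rewrite /encode_nats /= size_cat.
by rewrite /unary_size /= leq_add ?size_encode_nat.
Qed.

Lemma unary_size_flatten (g : nat -> seq nat) (b a n : nat) :
  (forall i, unary_size (g i) <= b) ->
  unary_size (flatten (map g (iota a n))) <= n * b.
Proof.
by move=> gb; elim: n a => // n IH a; rewrite /= unary_size_cat mulSn leq_add.
Qed.

Lemma unary_size_rows (n b : nat) (g : nat -> nat -> seq nat) :
  (forall i1 i2, unary_size (g i1 i2) <= b) ->
  unary_size (rows n g) <= (n + n) * ((n + n) * b).
Proof. by move=> gb; do 2!apply: unary_size_flatten => ?. Qed.

Lemma unary_size_entry (e m a b : nat) : a <= 3 * m -> b <= 3 * m ->
  unary_size (entry_code e a b) <= 3 * m * 2 ^ e + 5.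
Proof.
move=> am bm; rewrite /unary_size /=.
have : (a - b + (b - a)) * 2 ^ e <= 3 * m * 2 ^ e by rewrite leq_mul2r; lia.
by case: (a < b); lia.
Qed.

Definition network_size (e n m : nat) : nat :=
  n + 1 + ((n + n) * (n + n) + 1 + ((n + n) * ((n + n) * (n * (3 * m * 2 ^ e + 5))) +
    ((n + n) * ((n + n) * (3 * m * 2 ^ e + 5)) + (n + n) * ((n + n) * 4)))).

Lemma size_network_code (e n : nat) (cs : seq nclause) :
  size (encode_nats (network_numbers e n cs)) <= network_size e n (size cs).
Proof.
apply: leq_trans (size_encode_nats _) _.
rewrite -[network_numbers _ _ _]/([:: n] ++ [:: (n + n) * (n + n)] ++ _).
rewrite !unary_size_cat /network_size.
rewrite leq_add //; first by rewrite /unary_size /=; lia.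
rewrite leq_add //; first by rewrite /unary_size /=; lia.
rewrite leq_add ?leq_add // unary_size_rows // => i1 i2.
- apply: unary_size_flatten => j; apply: unary_size_entry.
    by apply: clause_sum_le3; exact: weight_pos_le3.
  by apply: clause_sum_le3; exact: weight_neg_le3.
- apply: unary_size_entry.
    by apply: clause_sum_le3; exact: bias_pos_le3.
  by apply: clause_sum_le3; exact: bias_neg_le3.
Qed.

(** * Polynomial bounds and their closure properties *)

Definition poly_bounded (f : nat -> nat) : Prop :=
  exists d, forall x, f x <= d * x.+1 ^ d.

Lemma poly_bounded_cst (c : nat) : poly_bounded (fun=> c).
Proof. by exists c => x; rewrite leq_pmulr // expn_gt0. Qed.

Lemma poly_bounded_id : poly_bounded id.
Proof. by exists 1 => x; rewrite mul1n expn1. Qed.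

Lemma poly_bounded_add (f g : nat -> nat) :
  poly_bounded f -> poly_bounded g -> poly_bounded (fun x => f x + g x).
Proof.
move=> [c fc] [d gd]; exists (c + d) => x; rewrite mulnDl leq_add //.
  by apply: leq_trans (fc x) _; rewrite leq_mul // leq_pexp2l // leq_addr.
by apply: leq_trans (gd x) _; rewrite leq_mul // leq_pexp2l // leq_addl.
Qed.

Lemma poly_bounded_mul (f g : nat -> nat) :
  poly_bounded f -> poly_bounded g -> poly_bounded (fun x => f x * g x).
Proof.
(* The coefficient has to reach $cd$ and the exponent $c+d$; one constant serves as both. *)
move=> [c fc] [d gd]; exists (c * d + (c + d)) => x.
apply: leq_trans (leq_mul (fc x) (gd x)) _.
by rewrite mulnACA -expnD leq_mul // ?leq_addr // leq_pexp2l // leq_addl.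
Qed.

Lemma poly_bounded_exp (f : nat -> nat) (c : nat) :
  poly_bounded f -> poly_bounded (fun x => f x ^ c).
Proof.
move=> fb; elim: c => [|c IH]; first exact: (poly_bounded_cst 1).
case: (poly_bounded_mul fb IH) => d Hd.
by exists d => x; rewrite expnS.
Qed.

Ltac poly_bounded_tac :=
  repeat first [exact: poly_bounded_cst | exact: poly_bounded_id
    | apply: poly_bounded_add | apply: poly_bounded_mul | apply: poly_bounded_exp].

Lemma poly_bounded_reduction_time (e : nat) :
  poly_bounded (fun x => reduction_time e x x x).
Proof. by rewrite /reduction_time /rows_time /entry_time; poly_bounded_tac. Qed.

Lemma poly_bounded_network_size (e : nat) :
  poly_bounded (fun x => network_size e x x).
Proof. by rewrite /network_size; poly_bounded_tac. Qed.

(** Monotonicity lets one variable stand for all three sizes. *)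
Lemma reduction_time_le (e n m l x : nat) : n <= x -> m <= x -> l <= x ->
  reduction_time e n m l <= reduction_time e x x x.
Proof.
move=> nx mx lx; rewrite /reduction_time /rows_time /entry_time.
by repeat (apply: leq_add || apply: leq_mul || exact: leqnn || assumption).
Qed.

Lemma network_size_le (e n m x : nat) : n <= x -> m <= x ->
  network_size e n m <= network_size e x x.
Proof.
move=> nx mx; rewrite /network_size.
by repeat (apply: leq_add || apply: leq_mul || exact: leqnn || assumption).
Qed.

(* Registers 26, 28 and 29 are those holding the end of the scratch memory, a
   scratch value, and the length of the output of the reduction. *)
Definition sat_program (e : nat) (P : program) : program :=
  compile 0 (reduction e) ++
  shift_program 29 26 28 (size (compile 0 (reduction e))) P.

Lemma run_sat_program (e : nat) (P : program) (phi : formula3) (t : nat) (ans : bool) :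
  let n := nvars phi in
  let w := encode_nats (formula3_code phi) in
  run P t (init (encode_nats (inversion_code (reduced e phi)))) = Some ans ->
  exists2 t', t' <= reduction_time e n (size (clauses phi)) (size w) &
    run (sat_program e P) (t' + t.*2) (init w) = Some ans.
Proof.
move=> n w; rewrite inversion_code_reduced; set o := encode_nats _ => run_o.
have := @runs_reduction n (nclauses phi) w e.
rewrite -formula3_codeE -/o size_map => /(_ erefl).
set s := (X in runs _ _ _ X) => reduces.
have [t' t'_le E] :=
  reduces [::] (shift_program 29 26 28 (size (compile 0 (reduction e))) P).
exists t' => //.
have -> : init w = config_at 0 ([:: size w], w).
  by congr Config; apply: funext => -[|i] //; rewrite /= nth_nil.
have -> : run (sat_program e P) (t' + t.*2) (config_at 0 ([:: size w], w)) =
    run (sat_program e P) t.*2 (config_at (csize (reduction e)) s) by exact: E.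
rewrite -(size_compile (reduction e) 0).
(* Registers above 29 are still 0, and the output starts at the address in register 26. *)
apply: run_shift_program run_o => //.
- by rewrite addn0.
- by case=> [|i] //; rewrite [RHS]/= /s /= nth_nil.
- by move=> a; rewrite /s /= nth_cat ltnNge leq_addl /= addnK.
Qed.

(** * Exponentials absorb polynomials, and the final time bound *)

Local Open Scope ring_scope.

(** Put $d=g\ln 2$ and use $e^{dn}\ge 1+dn$. A number $k>1+1/d$ satisfies $k\ge 1$ and $kd\ge 1$,
    hence $k(1+dn)\ge n+1$. *)
Lemma succn_le_powR (R : realType) (g : R) : 0 < g ->
  exists k : nat, forall n : nat, n.+1%:R <= k%:R * 2 `^ (g * n%:R).
Proof.
move=> g0; have d0 : 0 < g * ln 2 :> R by rewrite mulr_gt0 // ln_gt0 // ltr1n.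
set d := g * ln 2 in d0.
have dv0 : 0 <= 1 + d^-1 by rewrite addr_ge0 // invr_ge0 ltW.
exists (Num.bound (1 + d^-1)) => n; set k := Num.bound _.
have k_gt : 1 + d^-1 < k%:R := archi_boundP dv0.
have k1 : 1 <= k%:R :> R by apply: le_trans (ltW k_gt); rewrite lerDl invr_ge0 ltW.
have kd : 1 <= k%:R * d.
  by rewrite -ler_pdivrMr // mul1r (le_trans _ (ltW k_gt)) // lerDr.
have : 1 + d * n%:R <= 2 `^ (g * n%:R).
  rewrite /powR ifF; last by rewrite pnatr_eq0.
  by rewrite (_ : _ * ln 2 = d * n%:R) ?expR_ge1Dx // /d; ring.
move=> /(ler_wpM2l (ler0n R k)); apply: le_trans.
rewrite mulrDr mulr1 mulrA -add1n natrD lerD //.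
by rewrite -[leLHS]mul1r ler_wpM2r.
Qed.

(** The linear bound for $g/(d+1)$ is raised to the power $d+1$; taking $d+1$ avoids dividing by
    0. *)
Lemma succn_exp_le_powR (R : realType) (g : R) (d : nat) : 0 < g ->
  exists k : nat, forall n : nat, (n.+1 ^ d)%:R <= k%:R * 2 `^ (g * n%:R).
Proof.
move=> g0; have gd0 : 0 < g / d.+1%:R by rewrite divr_gt0.
have [k Hk] := succn_le_powR gd0; exists (k ^ d.+1)%N => n.
apply: (@le_trans _ _ (n.+1%:R ^+ d.+1)); first by rewrite -natrX ler_nat leq_pexp2l.
rewrite natrX (_ : 2 `^ _ = (2 `^ (g / d.+1%:R * n%:R)) ^+ d.+1).
  by rewrite -exprMn lerXn2r ?nnegrE ?ler0n ?mulr_ge0 ?powR_ge0.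
rewrite -powR_mulrn ?powR_ge0 // -powRrM; congr (_ `^ _).
by field; rewrite addrC natr1 pnatr_eq0.
Qed.

Lemma leq_expn2r (m n d : nat) : (m <= n)%N -> (m ^ d <= n ^ d)%N.
Proof. by case: d => // d; rewrite leq_exp2r. Qed.

Theorem theorem5 (R : realType) :
  ETH R ->
  exists C : nat, forall (delta : R) (p : nat),
    0 < delta -> (0 < p)%N -> ~~ odd p ->
    exponentially_hard R (approx_inversion C p delta).
Proof.
(* The width is $(2n)^2=4n^2$. *)
move=> [g [g0 hard]]; exists 4%N => delta p d0 p0 _.
exists (g / 2); split=> [|[P [c HP]]]; first by rewrite divr_gt0.
apply: hard.
(* The scale depends on $\delta$ alone, so it is a constant of the program. *)
pose e := Num.bound delta.
have d_lt : delta < (2 ^ e)%:R.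
  by apply: lt_trans (archi_boundP (ltW d0)) _; rewrite ltr_nat ltn_expl.
(* The factor 2 pays for the two steps per instruction of the relocated program. *)
have [d Hd] : poly_bounded (fun x => reduction_time e x x x +
    2 * (c * (network_size e x x + 1) ^ c))%N.
  have := poly_bounded_reduction_time e; have := poly_bounded_network_size e.
  by move=> ? ?; poly_bounded_tac.
have [k Hk] := @succn_exp_le_powR R (g / 2) d (divr_gt0 g0 (ltr0n _ _ : 0 < 2%:R)).
(* The coefficient needed is $dk$ and the exponent $d$. *)
exists (sat_program e P), (d * k + d)%N => phi.
pose n := nvars phi; pose w := encode_nats (formula3_code phi).
have width_le : (width (reduced e phi) <= 4 * latent_dim (reduced e phi) ^ 2)%N.
  by rewrite /=; nia.
have [t [ans [t_le run_t ans_yes]]] := HP (exist _ (reduced e phi) width_le).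
have [t' t'_le run_t'] := run_sat_program run_t.
exists (t' + t.*2)%N, ans; split=> //; last first.
  by rewrite ans_yes; exact: (approx_invertible_reduced phi p0 (ltW d0) d_lt).
rewrite /= -/n -/w in t_le t'_le *.
(* Since [n] is written in binary, it can exceed the word length; hence the sum. *)
pose x := (n + size w)%N.
have m_le : (size (clauses phi) <= size w)%N.
  apply: leq_trans (size_le_encode_nats _).
  by rewrite formula3_codeE /= size_clauses size_map; lia.
have q1 : 1 <= 2 `^ (g / 2 * n%:R) :> R.
  rewrite -[leLHS](powRr0 2) ler_powR ?ler1n // mulr_ge0 // divr_ge0 // ltW //.
set q := 2 `^ (g / 2 * n%:R) in q1 t_le.
have q2 : 2 `^ (g * n%:R) = q * q.
  rewrite /q -powRD; last by rewrite pnatr_eq0 implybT.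
  by congr (_ `^ _); field.
rewrite /= -/n q2.
(* Uses $n+|w|+1\le(|w|+1)(n+1)$ to separate the two sizes. *)
have time_le : ((reduction_time e n (size (clauses phi)) (size w) +
    2 * (c * (size (encode_nats (inversion_code (reduced e phi)))).+1 ^ c)) <=
    d * ((size w).+1 ^ d * n.+1 ^ d))%N.
  rewrite inversion_code_reduced -expnMn.
  apply: leq_trans (leq_trans (Hd x) _); last first.
    rewrite leq_mul2l; apply/orP; right; apply: leq_expn2r.
    by rewrite /x; nia.
  rewrite leq_add //.
    by apply: reduction_time_le; rewrite /x ?leq_addr ?leq_addl // (leq_trans m_le) ?leq_addl.
  rewrite leq_mul // leq_mul //; apply: leq_expn2r; rewrite addn1 ltnS.
  apply: leq_trans (size_network_code _ _ _) _; rewrite size_map.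
  by apply: network_size_le; rewrite /x ?leq_addr // (leq_trans m_le) ?leq_addl.
move: time_le t_le; set A := (c * _ ^ c)%N; set r := reduction_time _ _ _ _ in t'_le *.
clearbody A r => time_le t_le.
(* One factor $q$ comes from the running time of [P]; the reduction is covered too, as $q\ge 1$. *)
apply: (@le_trans _ _ ((r + 2 * A)%:R * q)).
  have r_le : t'%:R <= r%:R * q.
    by apply: (@le_trans _ _ r%:R); [rewrite ler_nat | rewrite ler_peMr].
  by rewrite -mul2n (natrD _ t') (natrD _ r) !natrM; lra.
rewrite mulrA ler_wpM2r ?(le_trans ler01) //.
(* The other factor $q$ absorbs $(n+1)^d$. *)
apply: (@le_trans _ _ ((d * (size w).+1 ^ d)%:R * (k%:R * q))).
  apply: (@le_trans _ _ (d * (size w).+1 ^ d * n.+1 ^ d)%:R).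
    by rewrite ler_nat -mulnA.
  by rewrite natrM ler_wpM2l.
rewrite mulrA -natrM ler_wpM2r ?(le_trans ler01) // ler_nat.
by rewrite mulnAC leq_mul ?leq_addr // leq_pexp2l // leq_addl.
Qed.
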